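(* Let $f$ be a convex differentiable function and $\mathcal{X} \subseteq \mathbb{R}^d$ a closed convex set. Suppose that $\operatorname{dom} f \cap \mathcal{X}$ is relatively open in $\mathcal{X}$, and $f$ is twice continuously differentiable on $\operatorname{dom} f \cap \mathcal{X}$. Then $f$ is locally smooth relative to $h(\cdot) := \frac{1}{2} \| \cdot \|_2^2$ on $\mathcal{X}$.
   Context: $f$ may be extended-valued, with effective domain $\operatorname{dom} f$; $\operatorname{dom} \nabla f$ is the set of points where $\nabla f$ exists, and similarly for $h$. The set $\operatorname{dom} f \cap \mathcal{X}$ is relatively open in $\mathcal{X}$ if for every $x$ in it there is $\varepsilon_x > 0$ with $\mathcal{B}_{\varepsilon_x}(x) \cap \mathcal{X} \subseteq \operatorname{dom} f \cap \mathcal{X}$. For a convex differentiable function $h$, the Bregman divergence is $D_h(z_2, z_1) := h(z_2) - [ h(z_1) + \langle \nabla h(z_1), z_2 - z_1 \rangle ]$ for $(z_2, z_1) \in \operatorname{dom} h \times \operatorname{dom} \nabla h$; for $h = \frac12 \| \cdot \|_2^2$ it equals $\frac12 \| z_2 - z_1 \|_2^2$. Set $\tilde{\mathcal{X}} := \mathcal{X} \cap \operatorname{dom} \nabla f \cap \operatorname{dom} \nabla h$. Then $f$ is locally smooth relative to $h$ on $\mathcal{X}$ if for every $x \in \mathcal{X} \cap \operatorname{dom} f$ there exist $L_x > 0$ and $\varepsilon_x > 0$ such that $f(z_2) \leq f(z_1) + \langle \nabla f(z_1), z_2 - z_1 \rangle + L_x D_h(z_2, z_1)$ for all $z_1, z_2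 \in \mathcal{B}_{\varepsilon_x}(x) \cap \tilde{\mathcal{X}}$, where $\mathcal{B}_{\varepsilon_x}(x)$ is the ball centered at $x$ of radius $\varepsilon_x$ with respect to a norm. *)

(* Defs.v *)
From HB Require Import structures.
From mathcomp Require Import all_boot all_order all_algebra.
From mathcomp Require Import all_classical all_reals all_analysis.
Set Implicit Arguments.
Unset Strict Implicit.
Unset Printing Implicit Defensive.
Import Order.TTheory GRing.Theory Num.Theory.
Import numFieldNormedType.Exports.
Local Open Scope classical_set_scope.
Local Open Scope ring_scope.

(* R^d is ['rV[R]_d], whose library topology is the usual one; its library norm
   is the sup norm, so the Euclidean structure is introduced explicitly. *)

Definition dot (R : realType) (d : nat) (u v : 'rV[R]_d) : R :=
  \sum_(i < d) u 0 i * v 0 i.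

Definition norm2 (R : realType) (d : nat) (u : 'rV[R]_d) : R :=
  Num.sqrt (dot u u).

Record is_norm (R : realType) (d : nat) (N : 'rV[R]_d -> R) : Prop := IsNorm {
  is_norm_triangle : forall u v, N (u + v) <= N u + N v ;
  is_norm_scale : forall (a : R) u, N (a *: u) = `|a| * N u ;
  is_norm_eq0 : forall u, N u = 0 -> u = 0
}.

Definition nball (R : realType) (d : nat) (N : 'rV[R]_d -> R)
    (x : 'rV[R]_d) (e : R) : set 'rV[R]_d := [set z | N (z - x) < e].

Definition dom (R : realType) (d : nat) (f : 'rV[R]_d -> \bar R) :
  set 'rV[R]_d := [set x | (f x < +oo)%E].

(* Convex functions take values in ]-oo, +oo]; this excludes -oo, so that
   [fine \o f] is the real-valued restriction of [f] on [dom f]. *)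
Definition convex_ext (R : realType) (d : nat) (f : 'rV[R]_d -> \bar R) : Prop :=
  (forall x, (-oo < f x)%E) /\
  (forall (x y : 'rV[R]_d) (t : R), 0 < t -> t < 1 ->
    (f ((1 - t) *: x + t *: y)%R <= (1 - t)%R%:E * f x + t%:E * f y)%E).

(* The gradient of an extended-valued function can only exist at interior
   points of its domain. *)
Definition dom_grad (R : realType) (d : nat) (f : 'rV[R]_d -> \bar R) :
  set 'rV[R]_d :=
  [set x | interior (dom f) x /\ differentiable (fine \o f) x].

(* Meaningful on [dom_grad f] only. *)
Definition grad (R : realType) (d : nat) (f : 'rV[R]_d -> \bar R)
    (x : 'rV[R]_d) : 'rV[R]_d :=
  \row_(i < d) 'D_(delta_mx 0 i) (fine \o f) x.

(* Differentiability of an extended-valued function is required in the interior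
   of its domain, not at boundary points (e.g. the negative entropy). *)
Definition differentiable_ext (R : realType) (d : nat)
    (f : 'rV[R]_d -> \bar R) : Prop :=
  interior (dom f) `<=` dom_grad f.

Definition hessian (R : realType) (d : nat) (f : 'rV[R]_d -> \bar R)
    (x : 'rV[R]_d) : 'M[R]_d := jacobian (grad f) x.

(* The first two derivatives are the ordinary ones of R^d, even at points of a
   set [S] with empty interior; continuity of the Hessian is only required
   relative to [S]. *)
Definition C2_on (R : realType) (d : nat) (f : 'rV[R]_d -> \bar R)
    (S : set 'rV[R]_d) : Prop :=
  (forall x, S x -> interior (dom_grad f) x /\ differentiable (grad f) x) /\
  {within S, continuous (hessian f)}.

Definition relatively_open (R : realType) (d : nat) (N : 'rV[R]_d -> R)
    (S X : set 'rV[R]_d) : Prop :=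
  forall x, (S `&` X) x ->
    exists2 e : R, 0 < e & nball N x e `&` X `<=` S `&` X.

(* Used for [z2] in [dom h] and [z1] in [dom_grad h], where both values of [h]
   are finite. *)
Definition bregman (R : realType) (d : nat) (h : 'rV[R]_d -> \bar R)
    (z2 z1 : 'rV[R]_d) : \bar R :=
  (h z2 - (h z1 + (dot (grad h z1) (z2 - z1))%:E))%E.

Definition locally_smooth (R : realType) (d : nat) (N : 'rV[R]_d -> R)
    (f h : 'rV[R]_d -> \bar R) (X : set 'rV[R]_d) : Prop :=
  let Xt := X `&` dom_grad f `&` dom_grad h in
  forall x, (X `&` dom f) x ->
    exists L e : R, [/\ 0 < L, 0 < e &
      forall z1 z2, (nball N x e `&` Xt) z1 -> (nball N x e `&` Xt) z2 ->
        (f z2 <= f z1 + (dot (grad f z1) (z2 - z1))%:E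
                 + L%:E * bregman h z2 z1)%E].

Definition half_sqnorm2 (R : realType) (d : nat) (x : 'rV[R]_d) : \bar R :=
  (2^-1 * norm2 x ^+ 2)%:E.

(* Main.v *)
Require Import Defs.
From HB Require Import structures.
From mathcomp Require Import all_boot all_order all_algebra.
From mathcomp Require Import all_classical all_reals all_analysis.
From mathcomp Require Import ring lra.
Import Order.TTheory GRing.Theory Num.Theory.
Import numFieldNormedType.Exports.
Local Open Scope classical_set_scope.
Local Open Scope ring_scope.
Set Implicit Arguments.
Unset Strict Implicit.
Unset Printing Implicit Defensive.

(** Near a point [x] of [dom f `&` X] the Hessian is bounded, because it is
    continuous relative to that set, and a bounded Hessian is all that a
    quadratic upper bound needs.

    Choose a ball around [x] inside [dom f] on whose intersection with
    [dom f `&` X] the entries of the Hessian are at most [M] in absolute value.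
    For [z1], [z2] in the ball and in [X], the whole segment between them stays
    in the ball (balls of a norm are convex) and in [X] (which is convex), hence
    in [dom f `&` X], where [f] is twice differentiable with Hessian bounded by
    [M].  Along the segment, with [v = z2 - z1], the second derivative of [f] is
    the quadratic form of the Hessian at [v], at most [d * M * dot v v] by
    [quadratic_form_le]; so the one-dimensional estimate [taylor2_le] gives
    [f z2 <= f z1 + dot (grad f z1) v + d * M * dot v v / 2].  Since the Bregman
    divergence of half the squared Euclidean norm is [dot v v / 2]
    ([bregman_half_sqnorm2]), this is relative smoothness with constant [d * M],
    which is increased by 1 to be positive even when [d = 0].

    The balls of the conclusion are those of an arbitrary norm, whereas
    continuity and interiors refer to the topology of the sup norm.  The two are
    reconciled by the equivalence of norms in finite dimension, of which only
    [nball_nbhs] is used: every neighbourhood contains a ball of the given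
    norm. *)

(** * The dot product and quadratic forms *)

Lemma mx_norm_entry (R : realType) m n (A : 'M[R]_(m, n)) i j :
  `|A i j| <= `|A|.
Proof.
rewrite [leRHS]/Num.Def.normr /= mx_normrE.
exact: (le_bigmax 0 (fun ij : 'I_m * 'I_n => `|A ij.1 ij.2|) (i, j)).
Qed.

Section dot_theory.
Context {R : realType} {d : nat}.
Implicit Types u v w : 'rV[R]_d.

Lemma dotC u v : dot u v = dot v u.
Proof. by apply: eq_bigr => i _; rewrite mulrC. Qed.

Lemma dotDl u v w : dot (u + v) w = dot u w + dot v w.
Proof. by rewrite -big_split; apply: eq_bigr => i _; rewrite mxE mulrDl. Qed.

Lemma dotZl a u v : dot (a *: u) v = a * dot u v.
Proof. by rewrite mulr_sumr; apply: eq_bigr => i _; rewrite mxE mulrA. Qed.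

Lemma dotBl u v w : dot (u - v) w = dot u w - dot v w.
Proof. by rewrite dotDl -scaleN1r dotZl mulN1r. Qed.

Lemma dotBr u v w : dot u (v - w) = dot u v - dot u w.
Proof. by rewrite dotC dotBl !(dotC _ u). Qed.

Lemma dot0r u : dot u 0 = 0.
Proof. by rewrite -(subrr 0) dotBr subrr. Qed.

Lemma dot_delta u i : dot u (delta_mx 0 i) = u 0 i.
Proof.
rewrite /dot (bigD1 i) //= mxE !eqxx mulr1 big1 ?addr0 // => j ji.
by rewrite mxE eqxx /= (negbTE ji) mulr0.
Qed.

Lemma dot_ge0 u : 0 <= dot u u.
Proof. by apply: sumr_ge0 => i _; rewrite -expr2 sqr_ge0. Qed.

Lemma norm2_sqr u : norm2 u ^+ 2 = dot u u.
Proof. by rewrite sqr_sqrtr // dot_ge0. Qed.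

(** Bounding every entry of [A] by [`|A|] and every product [u_i u_j] by
    [(u_i ^ 2 + u_j ^ 2) / 2] turns the double sum into [d] copies of
    [dot u u]. *)
Lemma quadratic_form_le (A : 'M[R]_d) u :
  dot (u *m A) u <= d%:R * `|A| * dot u u.
Proof.
have -> : dot (u *m A) u = \sum_j \sum_i u 0 i * A i j * u 0 j.
  by apply: eq_bigr => j _; rewrite mxE mulr_suml.
have -> : d%:R * `|A| * dot u u =
    \sum_(j < d) \sum_(i < d) `|A| * ((u 0 i * u 0 i + u 0 j * u 0 j) / 2).
  transitivity (\sum_(j < d) (`|A| * (dot u u + d%:R * (u 0 j * u 0 j)) / 2)).
    rewrite -mulr_suml -mulr_sumr big_split /= sumr_const card_ord.
    by rewrite -mulr_sumr -mulr_natl -/(dot u u); field.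
  apply: eq_bigr => j _; rewrite -mulr_sumr -mulr_suml big_split /=.
  by rewrite sumr_const card_ord mulr_natl -[LHS]mulrA.
apply: ler_sum => j _; apply: ler_sum => i _.
rewrite mulrAC mulrC.
apply: (@le_trans _ _ (`|A| * `|u 0 i * u 0 j|)).
  apply: le_trans (ler_norm _) _.
  by rewrite normrM ler_wpM2r // mx_norm_entry.
rewrite ler_wpM2l // ler_norml.
have := sqr_ge0 (u 0 i + u 0 j); have := sqr_ge0 (u 0 i - u 0 j).
by rewrite !expr2 => h1 h2; apply/andP; split; nra.
Qed.

End dot_theory.

(** * Comparison of an arbitrary norm with the sup norm *)

Section norm_theory.
Context {R : realType} {d : nat} {N : 'rV[R]_d -> R} (normN : is_norm N).
Implicit Types u v : 'rV[R]_d.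

Lemma is_norm0 : N 0 = 0.
Proof. by rewrite -(scale0r 0) (is_norm_scale normN) normr0 mul0r. Qed.

Lemma is_normN u : N (- u) = N u.
Proof. by rewrite -scaleN1r (is_norm_scale normN) normrN1 mul1r. Qed.

Lemma is_norm_ge0 u : 0 <= N u.
Proof.
have := is_norm_triangle normN u (- u).
by rewrite subrr is_norm0 is_normN; lra.
Qed.

Lemma is_norm_le_sup : exists2 K, 0 < K & forall u, N u <= K * `|u|.
Proof.
exists (1 + \sum_(i < d) N (delta_mx 0 i)).
  by rewrite ltr_pwDl // sumr_ge0 // => i _; exact: is_norm_ge0.
move=> u; apply: (@le_trans _ _ (\sum_(i < d) `|u 0 i| * N (delta_mx 0 i))).
  rewrite {1}(row_sum_delta u).
  elim/big_ind2 : _ => [|a b a' b' ab ab'|i _].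
  - by rewrite is_norm0.
  - by apply: le_trans (is_norm_triangle normN _ _) _; exact: lerD.
  - by rewrite (is_norm_scale normN).
rewrite mulrDl mul1r mulr_suml ler_wpDl // ler_sum // => i _.
by rewrite mulrC ler_wpM2l ?is_norm_ge0 // mx_norm_entry.
Qed.

Lemma is_norm_continuous : continuous N.
Proof.
move=> u; have [K K0 leK] := is_norm_le_sup.
apply/(cvgrPdist_lt (FF := nbhs_filter u)) => e e0.
apply: (@filterS _ _ (nbhs_filter u)) (nbhsx_ballx u _ (divr_gt0 e0 K0)) => v.
rewrite -ball_normE /= => uv.
apply: (@le_lt_trans _ _ (N (u - v))).
  have := is_norm_triangle normN (u - v) v.
  have := is_norm_triangle normN (v - u) u.
  rewrite !subrK -(is_normN (v - u)) opprB => h1 h2.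
  by rewrite ler_norml; apply/andP; split; lra.
apply: le_lt_trans (leK _) _; by rewrite mulrC -ltr_pdivlMr.
Qed.

(** [c] is the minimum of [N] on the unit sphere of the sup norm, which is
    compact; it is positive because [N] is definite. *)
Lemma is_norm_ge_sup : exists2 c, 0 < c & forall u, c * `|u| <= N u.
Proof.
pose S := [set u : 'rV[R]_d | `|u| = 1].
have normS u : u != 0 -> S (`|u|^-1 *: u).
  by move=> u0; rewrite /S /= normrZ normfV normr_id mulVf // normr_eq0.
(* The sphere is empty when [d = 0]; then every vector is null. *)
have [S0|/set0P/negP/negPn/eqP S0] := pselect (S !=set0); last first.
  exists 1 => // u; have [->|/normS] := eqVneq u 0.
    by rewrite normr0 mulr0 is_norm0.
  by rewrite S0.
have cS : compact S.
  apply: bounded_closed_compact.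
    by exists 1; split => // M M1 u /= ->; exact: ltW.
  apply: (@preimage_closed _ _ (fun u : 'rV[R]_d => `|u|) [set 1]).
    by move=> u _; exact: norm_continuous.
  exact: closed_eq.
have [c] := EVT_min_rV S0 cS (continuous_subspaceT is_norm_continuous).
rewrite inE => Sc minc; exists (N c).
  rewrite lt_neqAle is_norm_ge0 andbT eq_sym; apply/eqP => /(is_norm_eq0 normN).
  by move: Sc; rewrite /S /= => + c0; rewrite c0 normr0; lra.
move=> u; have [->|u0] := eqVneq u 0; first by rewrite normr0 mulr0 is_norm0.
have := minc _ (mem_set (normS _ u0)).
by rewrite (is_norm_scale normN) normfV normr_id mulrC ler_pdivlMr ?normr_gt0.
Qed.

Lemma nball_nbhs {x} {U : set 'rV[R]_d} :
  nbhs x U -> exists2 e, 0 < e & nball N x e `<=` U.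
Proof.
have [c c0 cN] := is_norm_ge_sup.
move=> /nbhs_ballP[r /= r0 rU]; exists (c * r); first exact: mulr_gt0.
move=> z zx; apply: rU; rewrite -ball_normE /= distrC -(ltr_pM2l c0).
exact: le_lt_trans (cN _) zx.
Qed.

Lemma nball_segment x e y z (t : R) : 0 <= t <= 1 ->
  nball N x e y -> nball N x e z -> nball N x e (y + t *: (z - y)).
Proof.
rewrite /nball /= => /andP[t0 t1] yx zx.
have -> : y + t *: (z - y) - x = (1 - t) *: (y - x) + t *: (z - x).
  by apply/rowP => i; rewrite !mxE; ring.
apply: le_lt_trans (is_norm_triangle normN _ _) _.
rewrite !(is_norm_scale normN) (ger0_norm t0) ger0_norm ?subr_ge0 //.
have [->|tn0] := eqVneq t 0; first by rewrite subr0 mul1r mul0r addr0.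
have : 0 < t * (e - N (z - x)) by rewrite mulr_gt0 ?subr_gt0 // lt_def tn0.
have : 0 <= (1 - t) * (e - N (y - x)) by rewrite mulr_ge0 ?subr_ge0 // ltW.
by lra.
Qed.

End norm_theory.

Lemma convex_set_segment (R : realType) d (X : set 'rV[R]_d) y z (t : R) :
  convex_set X -> 0 <= t <= 1 -> X y -> X z -> X (y + t *: (z - y)).
Proof.
move=> convX t01 Xy Xz.
have := convX z y (Itv01 (proj1 (andP t01)) (proj2 (andP t01)))
  (mem_set Xz) (mem_set Xy).
rewrite inE /conv /=.
by congr X; apply/rowP => i; rewrite !mxE /unstable.onem; ring.
Qed.

(** * Derivatives along a segment *)

Section derivatives.
Context {R : realType}.

Lemma is_derive_line (V W : normedModType R) (g : V -> W) (a v : V) (t : R) :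
  differentiable g (a + t *: v) ->
  is_derive t 1 (fun s => g (a + s *: v)) ('D_v g (a + t *: v)).
Proof.
move=> dg.
have lin : is_diff t (fun s : R => a + s *: v) (fun s : R => s *: v).
  have [dl dlE] := is_diffD (is_diff_cst a t) (is_diff_scalel t v).
  apply: DiffDef; first exact: dl.
  by apply: etrans dlE _; rewrite add0r.
have dgl : differentiable (fun s : R => g (a + s *: v)) t.
  exact: (differentiable_comp (f := fun s : R => a + s *: v) ex_diff dg).
apply: DeriveDef; first exact: diff_derivable.
rewrite !deriveE // (diff_comp (f := fun s : R => a + s *: v) ex_diff dg).
by rewrite /= diff_val scale1r.
Qed.

Lemma is_derive_dot d (V : normedModType R) (w1 w2 : V -> 'rV[R]_d) (t h : V)
    (dw1 dw2 : 'rV[R]_d) :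
  is_derive t h w1 dw1 -> is_derive t h w2 dw2 ->
  is_derive t h (fun s => dot (w1 s) (w2 s)) (dot dw1 (w2 t) + dot (w1 t) dw2).
Proof.
have coord (w : V -> 'rV[R]_d) dw i : is_derive t h w dw ->
    is_derive t h (fun s => w s 0 i) (dw 0 i).
  move=> [wt <-]; rewrite derive_mx // mxE.
  by apply: derivableP; exact: (derivable_mxP w t h).1.
move=> dw1E dw2E.
have -> : (fun s => dot (w1 s) (w2 s)) =
    \sum_(i < d) ((fun s => w1 s 0 i) * (fun s => w2 s 0 i)).
  by apply/funext => s; rewrite fct_sumE.
have -> : dot dw1 (w2 t) + dot (w1 t) dw2 =
    \sum_(i < d) (w1 t 0 i *: dw2 0 i + w2 t 0 i *: dw1 0 i).
  rewrite addrC -big_split; apply: eq_bigr => i _ /=.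
  by rewrite /GRing.scale /= (mulrC (w2 t 0 i)).
by apply: is_derive_sum => i; apply: is_deriveM; exact: coord.
Qed.

Lemma is_derive_dotl d (V : normedModType R) (w : V -> 'rV[R]_d) (t h : V)
    (dw v : 'rV[R]_d) :
  is_derive t h w dw -> is_derive t h (fun s => dot (w s) v) (dot dw v).
Proof.
move=> dwE; have := is_derive_dot dwE (is_derive_cst v t h).
by rewrite dot0r addr0.
Qed.

Lemma derive_grad d (f : 'rV[R]_d -> \bar R) (z v : 'rV[R]_d) :
  differentiable (fine \o f) z -> 'D_v (fine \o f) z = dot (grad f z) v.
Proof.
move=> df; rewrite deriveE // {1}(row_sum_delta v) linear_sum /=.
by apply: eq_bigr => i _; rewrite linearZ /= mxE deriveE // mulrC.
Qed.

(** The mean value theorem applied to [dphi] gives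
    [dphi t - dphi 0 <= C * t]; applied once more, to [phi] minus its
    quadratic majorant, it shows that this difference does not grow on
    [[0, 1]].  No integration is involved, so [ddphi] may be discontinuous. *)
Lemma taylor2_le (phi dphi ddphi : R -> R) (C : R) :
  (forall t : R, 0 <= t <= 1 -> is_derive t 1 phi (dphi t)) ->
  (forall t : R, 0 <= t <= 1 -> is_derive t 1 dphi (ddphi t)) ->
  (forall t : R, 0 <= t <= 1 -> ddphi t <= C) ->
  phi 1 <= phi 0 + dphi 0 + C / 2.
Proof.
move=> dphiE ddphiE leC.
have cont (g dg : R -> R) (a b : R) : 0 <= a -> b <= 1 ->
    (forall t : R, 0 <= t <= 1 -> is_derive t 1 g (dg t)) ->
    {within `[a, b], continuous g}.
  move=> a0 b1 gE; apply: derivable_within_continuous => t.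
  rewrite in_itv /= => /andP[at_ tb].
  by have [] := gE t _; first by apply/andP; split; lra.
have dphi_le t : 0 <= t <= 1 -> dphi t - dphi 0 <= C * t.
  move=> /andP[t0 t1].
  have [||s] := @MVT_segment _ dphi ddphi 0 t t0.
  - move=> s; rewrite in_itv /= => /andP[s0 st].
    by apply: ddphiE; apply/andP; split; lra.
  - exact: cont ddphiE.
  rewrite in_itv /= => /andP[s0 st] ->; rewrite subr0 ler_wpM2r //.
  by apply: leC; apply/andP; split; lra.
pose g (t : R) := phi t - (dphi 0 * t + C / 2 * t ^+ 2).
have gE (t : R) : 0 <= t <= 1 -> is_derive t 1 g (dphi t - (dphi 0 + C * t)).
  move=> /dphiE dphit.
  have [dg dgE] := is_deriveB dphit (is_deriveD
    (is_deriveZ (dphi 0) (is_derive_id t 1))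
    (is_deriveZ (C / 2) (is_deriveX 2 (is_derive_id t 1)))).
  apply: DeriveDef; first exact: dg.
  by apply: etrans dgE _; rewrite /GRing.scale /= expr1; field.
have [||s] := @MVT_segment _ g (fun t => dphi t - (dphi 0 + C * t)) 0 1 ler01.
- move=> s; rewrite in_itv /= => /andP[s0 s1].
  by apply: gE; apply/andP; split; lra.
- exact: cont gE.
rewrite in_itv /= /g => /dphi_le; lra.
Qed.

End derivatives.

(** * The Bregman divergence of half the squared Euclidean norm *)

Lemma grad_half_sqnorm2 (R : realType) d (z : 'rV[R]_d) :
  grad (@half_sqnorm2 R d) z = z.
Proof.
apply/rowP => i; rewrite mxE.
have -> : fine \o @half_sqnorm2 R d = 2^-1 \*: (fun u => dot u u).
  by apply/funext => u /=; rewrite norm2_sqr.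
have zE := is_derive_id z (delta_mx 0 i : 'rV[R]_d).
have [_ ->] := is_deriveZ 2^-1 (is_derive_dot zE zE).
by rewrite dotC dot_delta /GRing.scale /=; lra.
Qed.

Lemma bregman_half_sqnorm2 (R : realType) d (z1 z2 : 'rV[R]_d) :
  bregman (@half_sqnorm2 R d) z2 z1 =
  (2^-1 * dot (z2 - z1) (z2 - z1))%:E.
Proof.
rewrite /bregman grad_half_sqnorm2 /half_sqnorm2 !norm2_sqr.
congr EFin; rewrite -[LHS]/(_ - (_ + _))%R.
by rewrite !dotBl !dotBr (dotC z1 z2); field.
Qed.

(** * Local relative smoothness *)

Theorem proposition2 (R : realType) (d : nat)
  (N : 'rV[R]_d -> R) (normN : is_norm N)
  (f : 'rV[R]_d -> \bar R) (convf : convex_ext f) (difff : differentiable_ext f)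
  (X : set 'rV[R]_d) (closedX : closed X) (convX : convex_set X)
  (openfX : relatively_open N (dom f) X)
  (C2f : C2_on f (dom f `&` X)) :
  locally_smooth N f (@half_sqnorm2 R d) X.
Proof.
move=> x [Xx fx]; have [fC2 hess_cont] := C2f.
pose H := hessian f.
have dom_x : nbhs x (dom f).
  by have [/nbhs_singleton[]] := fC2 _ (conj fx Xx : (dom f `&` X) x).
have hess_bound : nbhs x [set y | (dom f `&` X) y -> `|H y| < `|H x| + 1].
  have /subspace_continuousP/(_ x (conj fx Xx)) := hess_cont.
  by move/cvgr_norm_lt => /(_ (`|H x| + 1)); apply; rewrite ltrDl.
have [e e0 eU] := nball_nbhs normN (filterI dom_x hess_bound).
pose L := d%:R * (`|H x| + 1) + 1.
exists L, e; split => // [|z1 z2 [z1e [[z1X _] _]] [z2e [[z2X _] _]]].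
  by rewrite ltr_wpDl // mulr_ge0 // addr_ge0.
pose v := z2 - z1; pose z (t : R) := z1 + t *: v.
have zS (t : R) : 0 <= t <= 1 -> (dom f `&` X) (z t) /\ `|H (z t)| < `|H x| + 1.
  move=> t01; have [domz Hz] := eU _ (nball_segment normN t01 z1e z2e).
  have Sz : (dom f `&` X) (z t) by split => //; exact: convex_set_segment.
  by split => //; exact: Hz.
have z0 : z 0 = z1 by rewrite /z scale0r addr0.
have z_1 : z 1 = z2 by rewrite /z scale1r addrC subrK.
have diffz (t : R) : 0 <= t <= 1 -> differentiable (fine \o f) (z t).
  by move=> /zS[/fC2[/nbhs_singleton[_]]].
have taylor : fine (f (z 1)) <=
    fine (f (z 0)) + dot (grad f (z 0)) v + L * dot v v / 2.
  apply: (@taylor2_le _ (fun t => fine (f (z t))) (fun t => dot (grad f (z t)) v)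
    (fun t => dot (v *m H (z t)) v)) => t t01.
  - rewrite -derive_grad; last exact: diffz.
    by apply: (is_derive_line (g := fine \o f)); exact: diffz.
  - have [/fC2[_ dgrad] _] := zS t t01.
    rewrite -(deriveEjacobian _ dgrad).
    have dz : is_derive t 1 (fun s => grad f (z s)) ('D_v (grad f) (z t)).
      exact: is_derive_line.
    exact: (is_derive_dotl v dz).
  - have [_ /ltW Hz] := zS t t01.
    apply: le_trans (quadratic_form_le _ _) _.
    by rewrite ler_wpM2r ?dot_ge0 // ler_wpDr // ler_wpM2l.
have fin (y : 'rV[R]_d) : dom f y -> f y = (fine (f y))%:E.
  by move=> fy; rewrite fineK // fin_numElt convf.1.
rewrite z0 z_1 in taylor.
have [[f1 _] [f2 _]] := (eU _ z1e, eU _ z2e).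
rewrite bregman_half_sqnorm2 (fin _ f1) (fin _ f2) -EFinM -!EFinD lee_fin.
by apply: le_trans taylor _; rewrite -/v; lra.
Qed.
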